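(* Let $\Xi,\Xi'\in\mathrm{SPD}(n)$, $J_\Omega\in\mathrm{SS}(2n)$, $G\in\mathrm{Sp}(J_\Omega,J_{2n})$, $k\le n$, and let $(\Psi,\Phi)$ be the test and trial basis matrices of the corresponding symplectic balancing, with subsystem basis matrices $(\bar\Psi,\bar\Phi)$ and diagonal matrix $\Sigma_1$. Then: (a) $(\bar\Psi,\bar\Phi)$ balance $\Xi$ and $\Xi'$, i.e. $\bar\Phi\in O(\Xi,\Sigma_1)$ and $\bar\Psi\in O(\Xi',\Sigma_1)$. (b) $(\Psi,\Phi)$ balance $M=G^{-\tau}\mathrm{diag}(\Xi,\Xi')G^{-1}$ and $M'=G\,\mathrm{diag}(\Xi',\Xi)G^{\tau}$, i.e. $\Phi\in O(M,\mathrm{diag}(\Sigma_1,\Sigma_1))$ and $\Psi\in O(M',\mathrm{diag}(\Sigma_1,\Sigma_1))$. (c) The test and trial basis matrices $(\Psi,\Phi)$ correspond to a symplectic projection with $J_\Omega$ and $J_{2k}$, i.e. $\Phi\in\mathrm{Sp}(J_\Omega,J_{2k})$ and $\Psi=J_\Omega\Phi J_{2k}^{-1}$. (d) The test and trial basis matrices $(\Phi,\Psi)$ correspond to a symplectic projection with $J_{\Omega'}$ and $J_{2k}$, where $J_{\Omega'}=-J_\Omega^{-1}$, i.e. $\Psi\in\mathrm{Sp}(J_{\Omega'},J_{2k})$ and $\Phi=J_{\Omega'}\Psi J_{2k}^{-1}$.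
   Context: $\mathrm{SPD}(m)$: real symmetric positive-definite $m\times m$ matrices. $\mathrm{SS}(m)$: real nonsingular skew-symmetric $m\times m$ matrices. $J_{2n}=\begin{bmatrix}0&I_n\\-I_n&0\end{bmatrix}$. $O(M,N)$: real full-column-rank matrices $V$ with $V^{\tau}MV=N$ ($M,N$ SPD). $\mathrm{Sp}(J_\Omega,J_\Pi)$: real full-column-rank $2n\times2k$ matrices $V$ with $V^{\tau}J_\Omega V=J_\Pi$ ($J_\Omega\in\mathrm{SS}(2n)$, $J_\Pi\in\mathrm{SS}(2k)$). $\tau$ denotes transpose. Symplectic balancing: write $\Xi=RR^{\tau}$, $\Xi'=SS^{\tau}$ with $R,S\in\mathbb{R}^{n\times n}$, take a singular value decomposition $R^{\tau}S=U\Sigma V^{\tau}$ with singular values in decreasing order, let $U_1,V_1\in\mathbb{R}^{n\times k}$ be the first $k$ columns of $U,V$ and $\Sigma_1$ the $k\times k$ diagonal matrix of the $k$ largest singular values. Put $\bar\Phi=SV_1\Sigma_1^{-1/2}$, $\bar\Psi=RU_1\Sigma_1^{-1/2}$. The trial and test basis matrices of the symplectic balancing are $\Phi=G\,\mathrm{diag}(\bar\Phi,\bar\Psi)$ and $\Psi=G^{-\tau}\,\mathrm{diag}(\bar\Psi,\bar\Phi)$. *)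

(* Defs.v *)
From mathcomp Require Import all_boot all_order all_algebra.
From mathcomp Require Export reals.

Set Implicit Arguments.
Unset Strict Implicit.
Unset Printing Implicit Defensive.

Import Order.TTheory GRing.Theory Num.Theory.
Local Open Scope ring_scope.

Section Defs.
Variable R : realType.

Definition SPD (m : nat) (A : 'M[R]_m) : Prop :=
  A^T = A /\ forall x : 'cV[R]_m, x != 0 -> 0 < (x^T *m A *m x) 0 0.

Definition SS (m : nat) (A : 'M[R]_m) : Prop :=
  A^T = - A /\ A \in unitmx.

Definition diag2 (m n p q : nat) (A : 'M[R]_(m, p)) (B : 'M[R]_(n, q)) :
    'M[R]_(m + n, p + q) :=
  block_mx A 0 0 B.

(* The dimension 2n is written n + n, so that block matrices apply. *)
Definition Jmx (n : nat) : 'M[R]_(n + n) :=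
  block_mx 0 1%:M (- 1%:M) 0.

(* The sets O(M, N) and Sp(J_Omega, J_Pi) are only defined for parameters in
   SPD, resp. SS; membership here includes these domain conditions. *)
Definition O_set (m r : nat) (M : 'M[R]_m) (N : 'M[R]_r)
    (V : 'M[R]_(m, r)) : Prop :=
  [/\ SPD M, SPD N, \rank V = r & V^T *m M *m V = N].

Definition Sp_set (n k : nat) (J_Omega : 'M[R]_(n + n)) (J_Pi : 'M[R]_(k + k))
    (V : 'M[R]_(n + n, k + k)) : Prop :=
  [/\ SS J_Omega, SS J_Pi, \rank V = (k + k)%N & V^T *m J_Omega *m V = J_Pi].

Definition balance (m r : nat) (M M' : 'M[R]_m) (N : 'M[R]_r)
    (Psi Phi : 'M[R]_(m, r)) : Prop :=
  O_set M N Phi /\ O_set M' N Psi.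

Definition symplectic_projection (n k : nat) (J_Omega : 'M[R]_(n + n))
    (J_Pi : 'M[R]_(k + k)) (Psi Phi : 'M[R]_(n + n, k + k)) : Prop :=
  Sp_set J_Omega J_Pi Phi /\ Psi = J_Omega *m Phi *m invmx J_Pi.

(* A = U diag(s) V^T with the singular values s in decreasing order. *)
Definition is_SVD (n : nat) (A U : 'M[R]_n) (s : 'rV[R]_n) (V : 'M[R]_n) :
    Prop :=
  [/\ U^T *m U = 1%:M,
      V^T *m V = 1%:M,
      forall i, 0 <= s 0 i,
      forall i j : 'I_n, (i <= j)%N -> s 0 j <= s 0 i
    & A = U *m diag_mx s *m V^T].

Definition first_cols (m n k : nat) (hk : (k <= n)%N) (A : 'M[R]_(m, n)) :
    'M[R]_(m, k) :=
  colsub (widen_ord hk) A.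

(* diag(s)^(-1/2), for a vector s of positive entries. *)
Definition diag_invsqrt (k : nat) (s : 'rV[R]_k) : 'M[R]_k :=
  diag_mx (map_mx (fun x => (Num.sqrt x)^-1) s).

(* The factors of Xi and Xi' and the singular value decomposition are not
   unique: any choice of them yields subsystem basis matrices. *)
Definition subsystem_bases (n k : nat) (hk : (k <= n)%N) (Xi Xi' : 'M[R]_n)
    (Psib Phib : 'M[R]_(n, k)) (Sigma1 : 'M[R]_k) : Prop :=
  exists (Rf Sf U V : 'M[R]_n) (s : 'rV[R]_n),
    let s1 := first_cols hk s in
    [/\ Xi = Rf *m Rf^T /\ Xi' = Sf *m Sf^T,
        is_SVD (Rf^T *m Sf) U s V,
        Sigma1 = diag_mx s1,
        Phib = Sf *m first_cols hk V *m diag_invsqrt s1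
      & Psib = Rf *m first_cols hk U *m diag_invsqrt s1].

Definition symplectic_balancing (n k : nat) (hk : (k <= n)%N)
    (Xi Xi' : 'M[R]_n) (G : 'M[R]_(n + n))
    (Psib Phib : 'M[R]_(n, k)) (Sigma1 : 'M[R]_k)
    (Psi Phi : 'M[R]_(n + n, k + k)) : Prop :=
  [/\ subsystem_bases hk Xi Xi' Psib Phib Sigma1,
      Phi = G *m diag2 Phib Psib
    & Psi = (invmx G)^T *m diag2 Psib Phib].

End Defs.

Arguments Jmx R n : clear implicits.

(* Main.v *)
(* From the SVD [R^T S V_1 = U_1 Sigma_1] and [S^T R U_1 = V_1 Sigma_1] follow
   [Phib^T Xi Phib = Sigma_1 = Psib^T Xi' Psib] and [Phib^T Psib = 1]; the
   identity [J_Omega G = G^-T J_2n] then transports these relations to [Phi] and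
   [Psi], and (d) follows from (c) by inverting [J_Omega] and [J_2k]. *)

Require Import Defs.
From mathcomp Require Import all_boot all_order all_algebra.
From mathcomp Require Import reals.

Set Implicit Arguments.
Unset Strict Implicit.
Unset Printing Implicit Defensive.

Import Order.TTheory GRing.Theory Num.Theory.
Local Open Scope ring_scope.

(** * Positive definiteness and full column rank *)

Lemma SPD_unitmx (R : realType) (m : nat) (A : 'M[R]_m) :
  SPD A -> A \in unitmx.
Proof.
case=> _ posA; rewrite unitmxE unitfE; apply/det0P => -[v v_neq0 vA0].
have := posA v^T; rewrite trmxK vA0 mul0mx mxE ltxx.
by rewrite -trmx0 (inj_eq trmx_inj) => /(_ v_neq0).
Qed.

Lemma SPD_congr (R : realType) (m : nat) (A P : 'M[R]_m) :
  SPD A -> P \in unitmx -> SPD (P^T *m A *m P).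
Proof.
move=> [symA posA] uP; split=> [|x x_neq0].
  by rewrite !trmx_mul trmxK symA mulmxA.
have := posA (P *m x); rewrite trmx_mul !mulmxA; apply.
by apply: contra_neq x_neq0 => Px0; rewrite -(mulKmx uP x) Px0 mulmx0.
Qed.

(** A nonzero stacked vector has a nonzero block; the form of that block is positive and the other
    is nonnegative. *)
Lemma SPD_diag2 (R : realType) (m n : nat) (A : 'M[R]_m) (B : 'M[R]_n) :
  SPD A -> SPD B -> SPD (diag2 A B).
Proof.
move=> [symA posA] [symB posB]; split=> [|x].
  by rewrite tr_block_mx symA symB !trmx0.
rewrite -[x]vsubmxK; set a := usubmx x; set b := dsubmx x => ab_neq0.
rewrite tr_col_mx mul_row_block mul_row_col !mulmx0 addr0 add0r mxE.
have ge0 p (C : 'M[R]_p) (y : 'cV_p) :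
    (forall z : 'cV_p, z != 0 -> 0 < (z^T *m C *m z) 0 0) ->
  0 <= (y^T *m C *m y) 0 0.
  move=> posC; have [->|/posC/ltW//] := eqVneq y 0.
  by rewrite mulmx0 mxE.
have [a0|/posA a_gt0] := eqVneq a 0; last exact: ltr_wpDr (ge0 _ _ _ posB) _.
have [b0|/posB b_gt0] := eqVneq b 0; last exact: ltr_wpDl (ge0 _ _ _ posA) _.
by rewrite a0 b0 col_mx0 eqxx in ab_neq0.
Qed.

Lemma SPD_diag_mx (R : realType) (m : nat) (s : 'rV[R]_m) :
  (forall i, 0 < s 0 i) -> SPD (diag_mx s).
Proof.
move=> s_gt0; split=> [|x x_neq0]; first exact: tr_diag_mx.
rewrite mul_mx_diag mxE.
under eq_bigr do rewrite !mxE mulrAC -expr2.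
have term_ge0 i : 0 <= x i 0 ^+ 2 * s 0 i.
  by rewrite mulr_ge0 ?sqr_ge0 // ltW.
rewrite lt_neqAle sumr_ge0 // andbT eq_sym.
(* A vanishing sum of nonnegative terms [x_i^2 s_i] vanishes termwise. *)
apply: contra_neq x_neq0 => /eqP; rewrite psumr_eq0 // => /allP sum0.
apply/colP => i; rewrite mxE; apply/eqP.
have := sum0 i (mem_index_enum i).
by rewrite /= mulf_eq0 (gt_eqF (s_gt0 i)) orbF sqrf_eq0.
Qed.

(** [N] factors through [V], so the rank of [V] is at least [r]; this settles the rank clause of
    [O_set] and [Sp_set]. *)
Lemma rank_congr_unitmx (R : realType) (m r : nat) (M : 'M[R]_m)
    (N : 'M[R]_r) (V : 'M[R]_(m, r)) :
  V^T *m M *m V = N -> N \in unitmx -> \rank V = r.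
Proof.
move=> VMV uN; apply/eqP; rewrite eqn_leq rank_leq_col /=.
by rewrite -{1}(mxrank_unit uN) -VMV mxrankM_maxr.
Qed.

Lemma O_setI (R : realType) (m r : nat) (M : 'M[R]_m) (N : 'M[R]_r)
    (V : 'M[R]_(m, r)) :
  SPD M -> SPD N -> V^T *m M *m V = N -> O_set M N V.
Proof.
by move=> pM pN VMV; split=> //; apply: rank_congr_unitmx VMV (SPD_unitmx pN).
Qed.

Lemma Sp_setI (R : realType) (n k : nat) (J : 'M[R]_(n + n))
    (J' : 'M[R]_(k + k)) (V : 'M[R]_(n + n, k + k)) :
  SS J -> SS J' -> V^T *m J *m V = J' -> Sp_set J J' V.
Proof.
by move=> sJ sJ' VJV; split=> //; apply: rank_congr_unitmx VJV _; case: sJ'.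
Qed.

(** * The matrix [Jmx] and symplectic projections *)

Lemma mul_Jmx (R : realType) (n : nat) : Jmx R n *m Jmx R n = - 1%:M.
Proof.
rewrite mulmx_block !mul0mx !mulmx0 !addr0 !add0r mulmxN mulNmx mulmx1.
by rewrite scalar_mx_block opp_block_mx !oppr0.
Qed.

Lemma tr_Jmx (R : realType) (n : nat) : (Jmx R n)^T = - Jmx R n.
Proof.
by rewrite tr_block_mx opp_block_mx !linearN /= !trmx0 trmx1 oppr0 opprK.
Qed.

Lemma Jmx_unitmx (R : realType) (n : nat) : Jmx R n \in unitmx.
Proof.
have : Jmx R n *m - Jmx R n = 1%:M by rewrite mulmxN mul_Jmx opprK.
by case/mulmx1_unit.
Qed.

Lemma invmx_Jmx (R : realType) (n : nat) : invmx (Jmx R n) = - Jmx R n.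
Proof.
rewrite -[RHS](mulKmx (Jmx_unitmx R n)).
by rewrite mulmxN mul_Jmx opprK mulmx1.
Qed.

Lemma SS_Jmx (R : realType) (n : nat) : SS (Jmx R n).
Proof. by split; [exact: tr_Jmx | exact: Jmx_unitmx]. Qed.

Lemma SS_opp_inv (R : realType) (m : nat) (J : 'M[R]_m) :
  SS J -> SS (- invmx J).
Proof.
move=> [symJ uJ]; split; last by rewrite -scaleN1r unitmxZ ?unitmx_inv ?unitrN1.
rewrite linearN /= trmx_inv symJ; congr (- _).
by rewrite -!scaleN1r invmxZ ?invrN1 // unitmxZ ?unitrN1.
Qed.

(** This swap is why [Psi] and [Phi] carry the subsystem bases in opposite orders. *)
Lemma Jmx_diag2 (R : realType) (n k : nat) (A B : 'M[R]_(n, k)) :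
  Jmx R n *m diag2 A B = diag2 B A *m Jmx R k.
Proof.
rewrite !mulmx_block !mul0mx !mulmx0 !addr0 !add0r.
by rewrite !mul1mx !mulmx1 mulNmx mulmxN mul1mx mulmx1.
Qed.

Lemma diag2_congr (R : realType) (m n p q : nat) (A : 'M[R]_m) (B : 'M[R]_n)
    (V : 'M[R]_(m, p)) (W : 'M[R]_(n, q)) :
  (diag2 V W)^T *m diag2 A B *m diag2 V W
    = diag2 (V^T *m A *m V) (W^T *m B *m W).
Proof.
by rewrite tr_block_mx !trmx0 !mulmx_block !(mul0mx, mulmx0, addr0, add0r).
Qed.

(** Since [Jmx] has inverse [- Jmx], the formula for [Psi] gives [- invmx J *m Psi = Phi *m Jmx R k]
    and [Psi^T = - Jmx R k *m Phi^T *m J]. The congruence then collapses to minus the cube of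
    [Jmx R k], which is [Jmx R k]. *)
Lemma symplectic_projection_dual (R : realType) (n k : nat)
    (J : 'M[R]_(n + n)) (Psi Phi : 'M[R]_(n + n, k + k)) :
  symplectic_projection J (Jmx R k) Psi Phi ->
  symplectic_projection (- invmx J) (Jmx R k) Phi Psi.
Proof.
move=> [[sJ _ _ PhiJPhi] defPsi].
have [symJ uJ] := sJ.
have invJPsi : - invmx J *m Psi = Phi *m Jmx R k.
  by rewrite defPsi invmx_Jmx mulmxN mulNmx mulmxN opprK -mulmxA mulKmx.
split; last first.
  by rewrite invJPsi mulmxK // Jmx_unitmx.
apply: Sp_setI (SS_opp_inv sJ) (SS_Jmx R k) _.
have trPsi : Psi^T = - (Jmx R k *m (Phi^T *m J)).
  rewrite defPsi invmx_Jmx mulmxN linearN /= !trmx_mul tr_Jmx symJ.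
  by rewrite mulmxN mulNmx mulmxN opprK.
rewrite -mulmxA invJPsi trPsi mulNmx -mulmxA (mulmxA _ Phi) PhiJPhi.
by rewrite mul_Jmx mulmxN mulmx1 opprK.
Qed.

(** The factor [G] reduces the congruence to [Jmx R n]. Once the blocks are swapped, what multiplies
    [Jmx R k] is the block diagonal of [Phib^T *m Psib] and its transpose, hence the identity. *)
Lemma symplectic_projection_lift (R : realType) (n k : nat)
    (J G : 'M[R]_(n + n)) (Psib Phib : 'M[R]_(n, k)) :
  SS J -> G \in unitmx -> G^T *m J *m G = Jmx R n ->
  Phib^T *m Psib = 1%:M ->
  symplectic_projection J (Jmx R k)
    ((invmx G)^T *m diag2 Psib Phib) (G *m diag2 Phib Psib).
Proof.
move=> sJ uG GJG PhiPsi; split.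
  apply: Sp_setI sJ (SS_Jmx R k) _.
  have -> : (G *m diag2 Phib Psib)^T *m J *m (G *m diag2 Phib Psib)
          = (diag2 Phib Psib)^T *m (G^T *m J *m G) *m diag2 Phib Psib.
    by rewrite trmx_mul !mulmxA.
  rewrite GJG -mulmxA Jmx_diag2 mulmxA tr_block_mx !trmx0 mulmx_block.
  rewrite !mul0mx !mulmx0 !addr0 !add0r PhiPsi.
  have -> : Psib^T *m Phib = 1%:M.
    by rewrite -[LHS]trmxK trmx_mul trmxK PhiPsi trmx1.
  by rewrite -scalar_mx_block mul1mx.
have JG : J *m G = (invmx G)^T *m Jmx R n.
  by rewrite -GJG trmx_inv -mulmxA mulKmx // unitmx_tr.
by rewrite mulmxA JG -(mulmxA _ (Jmx R n)) Jmx_diag2 mulmxA mulmxK // Jmx_unitmx.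
Qed.

(** * Truncated singular value decomposition *)

Section SVD.
Variables (R : realType) (n k : nat) (hk : (k <= n)%N).
Implicit Types (A U V : 'M[R]_n) (s : 'rV[R]_n).

Lemma is_SVD_tr A U s V : is_SVD A U s V -> is_SVD A^T V s U.
Proof.
move=> [UU VV s_ge0 s_dec ->]; split=> //.
by rewrite !trmx_mul trmxK tr_diag_mx mulmxA.
Qed.

(** The diagonal factor of an invertible product is invertible, so its determinant, the product of
    the [s 0 i], is nonzero. *)
Lemma is_SVD_gt0 A U s V :
  is_SVD A U s V -> A \in unitmx -> forall i, 0 < s 0 i.
Proof.
move=> [_ _ s_ge0 _ ->]; rewrite !unitmx_mul => /andP[/andP[_ uS] _] i.
rewrite lt0r s_ge0 andbT.
move: uS; rewrite unitmxE unitfE det_diag => /prodf_neq0; exact.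
Qed.

Lemma first_cols_orthonormal U :
  U^T *m U = 1%:M -> (first_cols hk U)^T *m first_cols hk U = 1%:M.
Proof.
move=> UU; apply/matrixP => i j.
have /matrixP/(_ (widen_ord hk i) (widen_ord hk j)) := UU.
(* [widen_ord] keeps the underlying number, so both Kronecker deltas agree by conversion. *)
rewrite !mxE => <-.
by apply: eq_bigr => l _; rewrite !mxE.
Qed.

(** Truncation of [A V = U diag(s)]: column [j] of the right side involves only column [j] of
    [U]. *)
Lemma is_SVD_first_cols A U s V :
  is_SVD A U s V ->
  A *m first_cols hk V = first_cols hk U *m diag_mx (first_cols hk s).
Proof.
move=> [_ VV _ _ ->].
have -> : first_cols hk V = V *m first_cols hk 1%:M.
  by rewrite /first_cols mulmx_colsub mulmx1.
rewrite -mulmxA (mulmxA V^T) VV mul1mx -mulmxA mul_diag_mx mul_mx_diag.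
apply/matrixP => i j; rewrite !mxE (bigD1 (widen_ord hk j)) //=.
rewrite big1 => [|l l_neq]; first by rewrite !mxE eqxx mulr1 addr0.
by rewrite !mxE (negPf l_neq) !mulr0.
Qed.

(** Positivity matters: at a zero entry the convention [0^-1 = 0] would give 0 instead of 1. *)
Lemma diag_invsqrtK (s : 'rV[R]_k) :
  (forall i, 0 < s 0 i) ->
  diag_invsqrt s *m diag_mx s *m diag_invsqrt s = 1%:M.
Proof.
move=> s_gt0; rewrite !mulmx_diag -diag_const_mx; congr diag_mx.
apply/rowP => i; rewrite !mxE mulrAC -invfM -expr2 sqr_sqrtr ?ltW //.
by rewrite mulVf // gt_eqF.
Qed.

(** The left side is the Gram matrix of [Rf^T *m Phib], which equals [U_1 Sigma_1 Sigma_1^(-1/2)];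
    orthonormality of [U_1] leaves only commuting diagonal factors. *)
Lemma SVD_balance (Rf Sf U V : 'M[R]_n) s :
  let s1 := first_cols hk s in
  let Phib := Sf *m first_cols hk V *m diag_invsqrt s1 in
  is_SVD (Rf^T *m Sf) U s V -> (forall i, 0 < s1 0 i) ->
  Phib^T *m (Rf *m Rf^T) *m Phib = diag_mx s1.
Proof.
move=> s1 Phib svd s1_gt0; have [UU _ _ _ _] := svd.
have RPhi : Rf^T *m Phib
    = first_cols hk U *m (diag_mx s1 *m diag_invsqrt s1).
  by rewrite /Phib !mulmxA (is_SVD_first_cols svd).
have -> : Phib^T *m (Rf *m Rf^T) *m Phib = (Rf^T *m Phib)^T *m (Rf^T *m Phib).
  by rewrite [(_ *m Phib)^T]trmx_mul trmxK !mulmxA.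
rewrite RPhi trmx_mul mulmxA -(mulmxA _ _ (first_cols hk U)).
rewrite first_cols_orthonormal // mulmx1 trmx_mul !tr_diag_mx.
have DS : diag_invsqrt s1 *m diag_mx s1 = diag_mx s1 *m diag_invsqrt s1.
  exact: diag_mxC.
by rewrite mulmxA {1}DS -!mulmxA (mulmxA (diag_invsqrt s1)) diag_invsqrtK ?mulmx1.
Qed.

(** The transposed decomposition turns [Sf^T Rf U_1] into [V_1 Sigma_1], and [V_1] is
    orthonormal. *)
Lemma SVD_biorthogonal (Rf Sf U V : 'M[R]_n) s :
  let s1 := first_cols hk s in
  is_SVD (Rf^T *m Sf) U s V -> (forall i, 0 < s1 0 i) ->
  (Sf *m first_cols hk V *m diag_invsqrt s1)^T
    *m (Rf *m first_cols hk U *m diag_invsqrt s1) = 1%:M.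
Proof.
move=> s1 svd s1_gt0; have [_ VV _ _ _] := svd.
have := is_SVD_first_cols (is_SVD_tr svd); rewrite trmx_mul trmxK => SRU.
rewrite !trmx_mul tr_diag_mx !mulmxA -(mulmxA _ Sf^T) -(mulmxA _ (Sf^T *m _)).
rewrite SRU mulmxA -(mulmxA _ _ (first_cols hk V)).
by rewrite first_cols_orthonormal // mulmx1 diag_invsqrtK.
Qed.

End SVD.

(** * Balancing of the subsystems and of the full system *)

Lemma subsystem_bases_spec (R : realType) (n k : nat) (hk : (k <= n)%N)
    (Xi Xi' : 'M[R]_n) (Psib Phib : 'M[R]_(n, k)) (Sigma1 : 'M[R]_k) :
  SPD Xi -> SPD Xi' -> subsystem_bases hk Xi Xi' Psib Phib Sigma1 ->
  balance Xi Xi' Sigma1 Psib Phib /\ Phib^T *m Psib = 1%:M.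
Proof.
move=> pXi pXi' [Rf [Sf [U [V [s [[defXi defXi'] svd -> -> ->]]]]]].
(* Invertibility of [Xi] and [Xi'] passes to their factors, so all singular values are positive. *)
have uA : Rf^T *m Sf \in unitmx.
  have := SPD_unitmx pXi; have := SPD_unitmx pXi'.
  rewrite defXi defXi' !unitmx_mul !unitmx_tr.
  by move=> /andP[-> _] /andP[->].
have s1_gt0 i : 0 < first_cols hk s 0 i.
  by rewrite mxE (is_SVD_gt0 svd).
split; last exact: SVD_biorthogonal svd s1_gt0.
(* Transposition exchanges [Rf] with [Sf] and [U] with [V], so [SVD_balance] also covers [Psib]. *)
have svd' : is_SVD (Sf^T *m Rf) V s U.
  by have := is_SVD_tr svd; rewrite trmx_mul trmxK.
split; apply: O_setI => //; try exact: SPD_diag_mx.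
  by rewrite defXi; apply: SVD_balance svd s1_gt0.
by rewrite defXi'; apply: SVD_balance svd' s1_gt0.
Qed.

Theorem lemma4p20 (R : realType) (n k : nat) (hk : (k <= n)%N)
    (Xi Xi' : 'M[R]_n) (J_Omega G : 'M[R]_(n + n))
    (Psib Phib : 'M[R]_(n, k)) (Sigma1 : 'M[R]_k)
    (Psi Phi : 'M[R]_(n + n, k + k))
    (hXi : SPD Xi) (hXi' : SPD Xi') (hJ : SS J_Omega)
    (hG : Sp_set J_Omega (Jmx R n) G)
    (hbal : symplectic_balancing hk Xi Xi' G Psib Phib Sigma1 Psi Phi) :
  [/\ balance Xi Xi' Sigma1 Psib Phib,
      balance ((invmx G)^T *m diag2 Xi Xi' *m invmx G)
              (G *m diag2 Xi' Xi *m G^T)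
              (diag2 Sigma1 Sigma1) Psi Phi,
      symplectic_projection J_Omega (Jmx R k) Psi Phi
    & symplectic_projection (- invmx J_Omega) (Jmx R k) Phi Psi].
Proof.
have [hsub -> ->] := hbal.
have [[OPhib OPsib] PhiPsi] := subsystem_bases_spec hXi hXi' hsub.
have [_ _ rankG GJG] := hG.
have uG : G \in unitmx by rewrite -row_full_unit /row_full rankG.
have hc := symplectic_projection_lift hJ uG GJG PhiPsi.
split=> //; last exact: symplectic_projection_dual.
have [_ pSigma1 _ PhiXiPhi] := OPhib; have [_ _ _ PsiXiPsi] := OPsib.
have pSigma2 := SPD_diag2 pSigma1 pSigma1.
split; apply: O_setI => //.
- by apply: SPD_congr; [exact: SPD_diag2 | rewrite unitmx_inv].
(* The two copies of [Sigma1] are expanded differently, which makes the right side a congruence of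
   [diag2 Xi Xi']; [G] then cancels. *)
- rewrite -{1}PhiXiPhi -PsiXiPsi.
  rewrite -diag2_congr trmx_mul -!mulmxA mulKmx // !mulmxA.
  by rewrite -(mulmxA _ G^T) -trmx_mul mulVmx // trmx1 mulmx1.
(* Writing [G] as [G^T^T] exhibits a congruence by [G^T]. *)
- rewrite -{1}[G]trmxK; apply: SPD_congr; first exact: SPD_diag2.
  by rewrite unitmx_tr.
- rewrite -{1}PsiXiPsi -PhiXiPhi -diag2_congr trmx_mul trmxK -!mulmxA.
  rewrite (mulmxA G^T) -trmx_mul mulVmx // trmx1 mul1mx.
  by rewrite mulKmx.
Qed.
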